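(* Let $n$ be a positive integer and let $G_1$ and $G_2$ be two $n$-isoclinic groups. For every subgroup $H_1$ of $G_1$, there exists a subgroup $H_2$ of $G_2$ such that $H_1$ and $H_2$ are $n$-isoclinic.
   Context: Groups may be finite or infinite. $Z_n(G)$ denotes the $n$-th term of the upper central series of $G$ ($Z_0(G)=1$, $Z_1(G)=Z(G)$), and $\gamma_{n+1}(G)$ denotes the $(n+1)$-th term of the lower central series ($\gamma_1(G)=G$, $\gamma_{k+1}(G)=[\gamma_k(G),G]$). Commutators are left-normed: $[x_1,x_2]=x_1^{-1}x_2^{-1}x_1x_2$ and $[x_1,\dots,x_{k+1}]=[[x_1,\dots,x_k],x_{k+1}]$. Definition ($n$-isoclinic groups). Two groups $G$ and $H$ are $n$-isoclinic if there is a pair $(\alpha,\beta)$ (an $n$-isoclinism from $G$ to $H$) such that: (i) $\alpha: G/Z_n(G)\to H/Z_n(H)$ is an isomorphism; (ii) $\beta:\gamma_{n+1}(G)\to\gamma_{n+1}(H)$ is an isomorphism; (iii) for all $g_1,\dots,g_{n+1}\in G$ and all $h_1,\dots,h_{n+1}\in H$ with $\alpha(g_iZ_n(G))=h_iZ_n(H)$ for $1\le i\le n+1$, one has $\beta([g_1,\dots,g_{n+1}])=[h_1,\dots,h_{n+1}]$. (This is the commutativity of the diagram formed by $\alpha^{n+1}$, $\beta$ and the well-defined commutator maps $(g_1Z_n(G),\dots,g_{n+1}Z_n(G))\mapsto[g_1,\dots,g_{n+1}]$ for $G$ and likewise for $H$.) *)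

(* Defs.v *)
From HB Require Import structures.
From mathcomp Require Import all_boot.
From mathcomp Require Import boolp.

(* MathComp, with the classical axioms of mathcomp.classical.boolp, which turn
   arbitrary propositions into boolean membership predicates. A [groupType] is
   an arbitrary (possibly infinite) group; its choice operator is available on
   any type from these axioms. Subgroups of [G] are [groupClosed G]. *)

Set Implicit Arguments.
Unset Strict Implicit.
Unset Printing Implicit Defensive.

Local Open Scope group_scope.
Local Open Scope quotient_scope.

Section Subgroup.
Variables (G : groupType) (H : groupClosed G).

Definition subgroup_type := {x : G | x \in H}.

HB.instance Definition _ := SubChoice.on subgroup_type.

Fact subgroup_group_closed : group_closed H.
Proof. by split=> [|x y]; [exact: gpred1 | exact: gpredF]. Qed.

HB.instance Definition _ := SubChoice_isSubGroup.Build G (mem H) subgroup_type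
  subgroup_group_closed.

End Subgroup.

HB.mixin Record isConjClosed (G : groupType) (S : {pred G}) := {
  gpredJr : {in S, forall x y, x ^ y \in S}
}.

#[short(type="normalClosed")]
HB.structure Definition NormalClosed (G : groupType) :=
  {S of GroupClosed G S & isConjClosed G S}.

Definition mk_subgroup (G : groupType) (S : {pred G})
    (clS : group_closed S) : groupClosed G :=
  GroupClosed.Pack (GroupClosed.Class
    (isInvClosed.Build G S (group_closedV clS))
    (isMul1Closed.Build G S clS.1)
    (isMulClosed.Build G S (group_closedM clS))).

Definition mk_normal_subgroup (G : groupType) (S : {pred G})
    (clS : group_closed S) (conjS : {in S, forall x y, x ^ y \in S}) :
    normalClosed G :=
  NormalClosed.Pack (NormalClosed.Class
    (isInvClosed.Build G S (group_closedV clS))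
    (isMul1Closed.Build G S clS.1)
    (isMulClosed.Build G S (group_closedM clS))
    (isConjClosed.Build G S conjS)).

Section Quotient.
Variables (G : groupType) (N : normalClosed G).

Definition coset_rel : rel G := fun x y => x^-1 * y \in N.

Fact coset_rel_refl : reflexive coset_rel.
Proof. by move=> x; rewrite /coset_rel mulVg gpred1. Qed.

Fact coset_rel_sym : symmetric coset_rel.
Proof. by move=> x y; rewrite /coset_rel -gpredV invgM invgK. Qed.

Fact coset_rel_trans : transitive coset_rel.
Proof.
move=> y x z Nxy Nyz; rewrite /coset_rel -[z](mulVKg y) mulgA.
exact: gpredM.
Qed.

Canonical coset_equiv :=
  EquivRel coset_rel coset_rel_refl coset_rel_sym coset_rel_trans.

Definition quotient_type := {eq_quot coset_rel}.

HB.instance Definition _ := Choice.on quotient_type.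
HB.instance Definition _ := EqQuotient.on quotient_type.

Definition quotient_proj (x : G) : quotient_type := \pi x.

Definition quotient_mul (a b : quotient_type) := quotient_proj (repr a * repr b).
Definition quotient_inv (a : quotient_type) := quotient_proj (repr a)^-1.

Fact quotient_projP x y :
  reflect (quotient_proj x = quotient_proj y) (x^-1 * y \in N).
Proof. exact: (@eqmodP _ coset_equiv). Qed.

Fact quotient_reprK a : quotient_proj (repr a) = a.
Proof. exact: reprK. Qed.

Fact quotient_projM x y :
  quotient_proj (x * y) = quotient_mul (quotient_proj x) (quotient_proj y).
Proof.
rewrite /quotient_mul.
have /esym/quotient_projP := quotient_reprK (quotient_proj x).
have /esym/quotient_projP := quotient_reprK (quotient_proj y).
move: (repr _) (repr _) => x' y' Ny Nx; apply/quotient_projP.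
have -> : (x * y)^-1 * (x' * y') = (x^-1 * x') ^ y * (y^-1 * y').
  by rewrite conjgE invgM !mulgA mulgK.
by rewrite gpredM // gpredJr.
Qed.

Fact quotient_projV x :
  quotient_proj x^-1 = quotient_inv (quotient_proj x).
Proof.
rewrite /quotient_inv.
have /quotient_projP := quotient_reprK (quotient_proj x).
move: (repr _) => x' Nx; apply/quotient_projP; rewrite invgK.
have -> : x * x'^-1 = (x'^-1 * x) ^ x'^-1 by rewrite conjgE invgK !mulgA mulgV mul1g.
exact: gpredJr.
Qed.

Fact quotient_mulA : associative quotient_mul.
Proof.
move=> a b c; rewrite -[a]quotient_reprK -[b]quotient_reprK -[c]quotient_reprK.
by rewrite -!quotient_projM mulgA.
Qed.

Fact quotient_mul1 : left_id (quotient_proj 1) quotient_mul.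
Proof. by move=> a; rewrite -[a]quotient_reprK -quotient_projM mul1g. Qed.

Fact quotient_mulr1 : right_id (quotient_proj 1) quotient_mul.
Proof. by move=> a; rewrite -[a]quotient_reprK -quotient_projM mulg1. Qed.

Fact quotient_mulV : left_inverse (quotient_proj 1) quotient_inv quotient_mul.
Proof.
move=> a; rewrite -[a]quotient_reprK.
by rewrite -quotient_projV -quotient_projM mulVg.
Qed.

Fact quotient_mulVr : right_inverse (quotient_proj 1) quotient_inv quotient_mul.
Proof.
move=> a; rewrite -[a]quotient_reprK.
by rewrite -quotient_projV -quotient_projM mulgV.
Qed.

HB.instance Definition _ := isGroup.Build quotient_type
  quotient_mulA quotient_mul1 quotient_mulr1 quotient_mulV quotient_mulVr.

HB.instance Definition _ :=
  isMultiplicative.Build G quotient_type quotient_proj quotient_projM.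
HB.instance Definition _ := Multiplicative_isUMagmaMorphism.Build
  G quotient_type quotient_proj erefl.

End Quotient.

Definition center (G : groupType) : {pred G} :=
  fun x => `[< forall y, commute x y >].
Arguments center : clear implicits.

Section UpperCentralSeries.
Variable G : groupType.

Fact trivial_closed : group_closed (pred1 (1 : G)).
Proof.
split; first by rewrite !inE.
by move=> x y; rewrite !inE => /eqP-> /eqP->; rewrite invg1 mulg1.
Qed.

Fact trivial_conj : {in pred1 (1 : G), forall x y, x ^ y \in pred1 (1 : G)}.
Proof. by move=> x /eqP-> y; rewrite !inE conj1g. Qed.

Definition trivial_subgroup : normalClosed G :=
  mk_normal_subgroup trivial_closed trivial_conj.

Section CenterMod.
Variable N : normalClosed G.

(* The full preimage in [G] of the center of [G / N]. *)
Definition center_mod_pred : {pred G} :=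
  fun x => quotient_proj N x \in center (quotient_type N).

Fact center_modP x : reflect
  (forall b, commute (quotient_proj N x) b) (x \in center_mod_pred).
Proof. exact: asboolP. Qed.

Fact center_mod_closed : group_closed center_mod_pred.
Proof.
split=> [|x y /center_modP Cx /center_modP Cy]; apply/center_modP=> b.
  by rewrite gmulf1; apply/commute_sym/commute1.
rewrite gmulfF; apply/commute_sym/commuteM; first exact/commute_sym.
exact/commuteV/commute_sym.
Qed.

Fact center_mod_conj :
  {in center_mod_pred, forall x y, x ^ y \in center_mod_pred}.
Proof.
move=> x /center_modP Cx y; apply/center_modP => b.
by rewrite gmulfJ conjgE Cx mulKg.
Qed.

Definition center_mod : normalClosed G :=
  mk_normal_subgroup center_mod_closed center_mod_conj.

End CenterMod.

Fixpoint upper_central (n : nat) : normalClosed G :=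
  if n is n'.+1 then center_mod (upper_central n') else trivial_subgroup.

End UpperCentralSeries.

Section LowerCentralSeries.
Variable G : groupType.

Section Generated.
Variable A : {pred G}.

Definition generated_pred : {pred G} :=
  fun x => `[< forall H : groupClosed G, {subset A <= H} -> x \in H >].

Fact generatedP x : reflect
  (forall H : groupClosed G, {subset A <= H} -> x \in H) (x \in generated_pred).
Proof. exact: asboolP. Qed.

Fact generated_closed : group_closed generated_pred.
Proof.
split=> [|x y /generatedP Ax /generatedP Ay]; apply/generatedP => H AH.
  exact: gpred1.
by apply: gpredF; [exact: Ax | exact: Ay].
Qed.

Definition generated : groupClosed G := mk_subgroup generated_closed.

End Generated.

Fact whole_closed : group_closed (predT : {pred G}).
Proof. by []. Qed.

Definition whole_group : groupClosed G := mk_subgroup whole_closed.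

Definition commutators (A B : {pred G}) : {pred G} :=
  fun z => `[< exists x y, [/\ x \in A, y \in B & z = [~ x, y]] >].

Fixpoint lower_central_rec (n : nat) : groupClosed G :=
  if n is n'.+1 then generated (commutators (lower_central_rec n') whole_group)
  else whole_group.

(* Indexed so that [lower_central 1] is [G] (and so is [lower_central 0]). *)
Definition lower_central (n : nat) : groupClosed G := lower_central_rec n.-1.

(* The left-normed commutator of a tuple; the library's [~ x, y] is
   x^-1 * (y^-1 * (x * y)). *)
Definition left_commutator (n : nat) (g : n.+1.-tuple G) : G :=
  foldl commg (thead g) (behead g).

Fact left_commutator_lower_central (n : nat) (g : n.+1.-tuple G) :
  left_commutator g \in lower_central n.+1.
Proof.
case/tupleP: g => x s; rewrite /left_commutator theadE /=.
suff H k (t : seq G) y : y \in lower_central_rec k ->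
    foldl commg y t \in lower_central_rec (size t + k).
  by have := H 0%N s x isT; rewrite addn0 size_tuple.
elim: t k y => // z t IHt k y yk.
have -> : size (z :: t) + k = size t + k.+1 by rewrite addnS.
apply: IHt.
apply/generatedP => H; apply; apply/asboolP.
by exists y, z.
Qed.

Definition commutator_map (n : nat) (g : n.+1.-tuple G) :
    subgroup_type (lower_central n.+1) :=
  exist _ (left_commutator g) (left_commutator_lower_central g).

End LowerCentralSeries.

Definition isoclinic (n : nat) (G H : groupType) : Prop :=
  exists (alpha : {multiplicative quotient_type (upper_central G n) ->
                                  quotient_type (upper_central H n)})
         (beta : {multiplicative subgroup_type (lower_central G n.+1) ->
                                 subgroup_type (lower_central H n.+1)}),
  [/\ bijective alpha,
      bijective beta
    & forall (g : n.+1.-tuple G) (h : n.+1.-tuple H),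
        (forall i, alpha (quotient_proj (upper_central G n) (tnth g i))
                   = quotient_proj (upper_central H n) (tnth h i)) ->
        beta (commutator_map g) = commutator_map h].

(* Main.v *)
Require Import Defs.
From HB Require Import structures.
From mathcomp Require Import all_boot.
From mathcomp Require Import boolp.

(** Write pi for the projections onto the quotients by the n-th upper centers,
    and let (alpha, beta) be an n-isoclinism from G1 to G2. The subgroup H2 is
    the full preimage in G2 of alpha (pi H1), so that the relation R x y,
    meaning alpha (pi x) = pi y, is a subgroup of H1 x H2 projecting onto both
    factors. By construction R matches the intersections of the Hi with Z_n(Gi),
    but it also matches the possibly larger groups Z_n(Hi), because these are
    characterized by commutators: an element x lies in Z_n(H) iff
    [x, y1, ..., yn] = 1 for all yi in H, and beta carries [x, y1, ..., yn] to
    the corresponding commutator in H2 and is injective. Hence R induces an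
    isomorphism H1 / Z_n(H1) -> H2 / Z_n(H2).

    The map beta itself restricts to an isomorphism between the groups
    gamma_{n+1}(Hi), since gamma_{n+1} is generated, as a subgroup, by the
    left-normed commutators of weight n+1 ([lower_central_ind]), which beta
    matches with one another.

    The compatibility condition must be checked for all representatives
    of the cosets modulo Z_n(H2), not only for those related by R. This is the
    well-definedness of the left-normed commutator on G / Z_n(G)
    ([left_commutator_congr]), which rests on
    [gamma_k(G), Z_{m+k}(G)] <= Z_m(G) ([commg_upper_lower_central]).

    [correspondence_isoclinic] carries this out for two groups linked by an
    abstract pair of relations, R as above and S in the role of the graph
    of beta. *)

Set Implicit Arguments.
Unset Strict Implicit.
Unset Printing Implicit Defensive.

Local Open Scope group_scope.

(** * Morphisms given by relations *)

Section Multiplicative.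
Variables (A B : groupType) (f : {multiplicative A -> B}).

Lemma multiplicativeF : {morph f : x y / x / y}.
Proof.
by move=> x y; apply: (mulIg (f y)); rewrite -gmulfM !mulgVK.
Qed.

Lemma multiplicative1 : f 1 = 1.
Proof. by rewrite -(mulgV 1) multiplicativeF mulgV. Qed.

End Multiplicative.

Section Correspondence.
Variables (A B : groupType) (R : A -> B -> Prop).

(** A subgroup of A x B that projects onto both factors and meets each of
    them trivially is the graph of an isomorphism. *)
Lemma correspondence_isomorphism :
    (forall a, exists b, R a b) -> (forall b, exists a, R a b) ->
    (forall a a' b b', R a b -> R a' b' -> R (a / a') (b / b')) ->
    (forall a b, R a b -> a = 1 <-> b = 1) ->
  exists2 f : {multiplicative A -> B},
    bijective f & forall a b, R a b -> f a = b.
Proof.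
move=> Rtotal Ronto Rdiv Rker.
have [[f Rf] [g Rg]] := (choice Rtotal, choice Ronto).
have Rfun a b b' : R a b -> R a b' -> b = b'.
  move=> Rab Rab'; apply/divg1_eq.
  by apply/(Rker _ _ (Rdiv _ _ _ _ Rab Rab')); rewrite mulgV.
have Rinj a a' b : R a b -> R a' b -> a = a'.
  move=> Rab Ra'b; apply/divg1_eq.
  by apply/(Rker _ _ (Rdiv _ _ _ _ Rab Ra'b)); rewrite mulgV.
have fM : {morph f : x y / x * y}.
  move=> x y; apply: Rfun (Rf _) _.
  have R11 : R 1 1 by have := Rdiv _ _ _ _ (Rf x) (Rf x); rewrite !mulgV.
  have := Rdiv _ _ _ _ (Rf x) (Rdiv _ _ _ _ R11 (Rf y)).
  by rewrite !div1g !invgK.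
pose fmul := isMultiplicative.Build A B f fM.
exists (HB.pack f fmul : {multiplicative A -> B}) => [|a b Rab] /=.
  exists g => [a|b]; first exact: Rinj (Rg _) (Rf _).
  exact: Rfun (Rf _) (Rg _).
exact: Rfun (Rf _) Rab.
Qed.

End Correspondence.

(** * Upper and lower central series *)

(** With c = [z, x] and d = [z, y], the two sides of z ^ (x * y) = z ^ (y * x)
    are z * d * c and z * c * d, which are equal as c is central. So z is fixed
    by (x * y) * (y * x)^-1 = [x^-1, y^-1]. This replaces the three subgroups
    lemma. *)
Lemma commute_commgV (G : groupType) (z x y : G) :
    (forall w, commute [~ z, x] w) -> commute [~ z, y] x ->
  commute z [~ x^-1, y^-1].
Proof.
set c := [~ z, x]; set d := [~ z, y] => Cc Cdx.
have zx : z ^ x = z * c by rewrite /c commgEl mulVKg.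
have zy : z ^ y = z * d by rewrite /d commgEl mulVKg.
(* c and d are themselves products, which rewriting must not unfold. *)
clearbody c d; have zxy : z ^ (x * y) = z ^ (y * x).
  rewrite !conjgM zx zy !conjMg zx zy.
  have -> : c ^ y = c by apply/conjg_fixP/commgP.
  have -> : d ^ x = d by apply/conjg_fixP/commgP.
  by rewrite -!mulgA Cc.
apply/commgP/conjg_fixP.
have -> : [~ x^-1, y^-1] = (x * y) * (y * x)^-1.
  by rewrite commgEl conjgE !invgK invgM !mulgA.
by rewrite conjgM zxy conjgK.
Qed.

Section Group.
Variable G : groupType.
Implicit Types (N : normalClosed G) (x y z : G).

Lemma quotient_proj_eq1 N x : quotient_proj N x = 1 <-> x \in N.
Proof.
split=> [/esym/quotient_projP|Nx]; first by rewrite invg1 mul1g.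
by apply/esym/quotient_projP; rewrite invg1 mul1g.
Qed.

Lemma commute_quotient_proj N x y :
  commute (quotient_proj N x) (quotient_proj N y) <-> [~ x, y] \in N.
Proof.
rewrite -quotient_proj_eq1 gmulfR; split=> [/commgP/eqP //|xy1].
by apply/commgP/eqP.
Qed.

Lemma mem_upper_centralS n x :
  x \in upper_central G n.+1 <-> forall y, [~ x, y] \in upper_central G n.
Proof.
split=> [/center_modP Zx y|Zx]; first exact/commute_quotient_proj.
apply/center_modP => b; rewrite -[b]quotient_reprK.
exact/commute_quotient_proj.
Qed.

(** This description of Z_n involves only commutators of weight n+1, the very
    elements on which an isoclinism is controlled. *)
Lemma mem_upper_central n x : x \in upper_central G n <->
  forall s : n.-tuple G, left_commutator [tuple of x :: s] = 1.
Proof.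
suff H : x \in upper_central G n <-> forall s : n.-tuple G, foldl commg x s = 1.
  exact: H.
elim: n x => [|n IHn] x.
  split=> [/eqP-> s|/(_ [tuple])/= ->]; first by rewrite tuple0.
  exact/eqP.
rewrite mem_upper_centralS; split=> [Zx s|Zx y].
  by case/tupleP: s => y s /=; apply: (iffLR (IHn _)).
by apply/IHn => s; apply: Zx [tuple of y :: s].
Qed.

Lemma generated_ind (X : {pred G}) (P : G -> Prop) :
    P 1 -> (forall x y, P x -> P y -> P (x / y)) -> {in X, forall x, P x} ->
  {in generated X, forall x, P x}.
Proof.
move=> P1 Pdiv PX x /generatedP Xx.
have clP : group_closed (fun y => `[< P y >]).
  by split=> [|y z /asboolP Py /asboolP Pz]; apply/asboolP => //; apply: Pdiv.
suff /asboolP : x \in mk_subgroup clP by [].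
by apply: Xx => y Xy; apply/asboolP/PX.
Qed.

Lemma sub_generated (X : {pred G}) : {subset X <= generated X}.
Proof. by move=> x Xx; apply/generatedP => H; apply. Qed.

Lemma generated_conj (X : {pred G}) :
    {in X, forall x y, x ^ y \in X} ->
  {in generated X, forall x y, x ^ y \in generated X}.
Proof.
move=> XJ; apply: generated_ind => [y|x x' Xx Xx' y|x Xx y].
- by rewrite conj1g gpred1.
- by rewrite conjMg conjVg gpredF.
- exact/sub_generated/XJ.
Qed.

Lemma lower_central_rec_conj k :
  {in lower_central_rec G k, forall x y, x ^ y \in lower_central_rec G k}.
Proof.
elim: k => // k IHk; apply: generated_conj.
move=> _ /asboolP [x [y [Lx _ ->]]] z; apply/asboolP.
by exists (x ^ z), (y ^ z); split=> //; [apply: IHk | rewrite conjRg].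
Qed.

Definition left_commutators k : {pred G} :=
  fun z => `[< exists s : k.+1.-tuple G, z = left_commutator s >].

Lemma left_commutator_morph (H : groupType) (f : G -> H) k (s : k.+1.-tuple G) :
    {morph f : x y / [~ x, y]} ->
  f (left_commutator s) = left_commutator (map_tuple f s).
Proof.
move=> fR; case/tupleP: s => x s.
rewrite /left_commutator /thead tnth_map !tnth0 /=.
by elim: {s}(tval s) x => //= y s IHs x; rewrite IHs fR.
Qed.

Lemma left_commutators_conj k :
  {in left_commutators k, forall x y, x ^ y \in left_commutators k}.
Proof.
move=> _ /asboolP [s ->] y; apply/asboolP; exists (map_tuple (conjg^~ y) s).
by apply: left_commutator_morph => a b; rewrite conjRg.
Qed.

(** Weight k+1 commutators generate the next term as a mere subgroup, not only
    as a normal one: [a / b, g] is a conjugate of [a, g] / [b, g], and the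
    left-normed commutators are stable under conjugation. *)
Lemma lower_central_rec_generated k :
  {subset lower_central_rec G k <= generated (left_commutators k)}.
Proof.
elim: k => [|k IHk] x.
  by move=> _; apply/sub_generated/asboolP; exists [tuple x].
move: x; apply: generated_ind; [exact: gpred1 | exact: gpredF |].
move=> _ /asboolP [a [g [/IHk La _ ->]]]; move: a La g.
apply: generated_ind => [g|a b La Lb g|_ /asboolP [s ->] g].
- by rewrite comm1g gpred1.
- have -> : [~ a / b, g] = ([~ a, g] / [~ b, g]) ^ b^-1.
    by rewrite invgR !commgEl !conjgE !invgM !invgK !mulgA !mulgK.
  by apply: generated_conj; [exact: left_commutators_conj | exact: gpredF].
- apply/sub_generated/asboolP; case/tupleP: s => x s.
  exists (cons_tuple x (rcons_tuple s g)).
  by rewrite /left_commutator !theadE /= foldl_rcons.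
Qed.

Lemma lower_central_ind k (P : G -> Prop) :
    P 1 -> (forall x y, P x -> P y -> P (x / y)) ->
    (forall s : k.+1.-tuple G, P (left_commutator s)) ->
  {in lower_central G k.+1, forall x, P x}.
Proof.
move=> P1 Pdiv PL x /lower_central_rec_generated; move: x.
by apply: generated_ind => // _ /asboolP [s ->].
Qed.

(** [gamma_{k+1}, Z_{m+k+1}] <= Z_m. For a generator [a, g] of gamma_{k+2},
    computing modulo Z_m, [z, a] is central and [z, g] commutes with a, both
    by induction, and [commute_commgV] applies. *)
Lemma commg_upper_lower_central k m a z :
    a \in lower_central_rec G k -> z \in upper_central G (m + k).+1 ->
  [~ z, a] \in upper_central G m.
Proof.
elim: k m a z => [|k IHk] m a z; first by rewrite addn0 mem_upper_centralS.
move=> La; rewrite addnS => Zz; apply/commute_quotient_proj.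
move: a La; apply: generated_ind => [|a b Ca Cb|_ /asboolP [a [g [La _ ->]]]].
- by rewrite gmulf1; apply: commute1.
- by rewrite gmulfF; apply: commuteM => //; apply: commuteV.
(* [commute_commgV] concerns a commutator of inverses. *)
rewrite -[a]invgK -[g]invgK gmulfR (gmulfV _ a^-1) (gmulfV _ g^-1).
have LaV : a^-1 \in lower_central_rec G k by rewrite gpredV.
apply: commute_commgV => [w|]; rewrite -gmulfR.
  rewrite -[w]quotient_reprK; apply/commute_quotient_proj.
  by apply: (iffLR (mem_upper_centralS _ _)); apply: IHk.
apply/commute_quotient_proj; apply: IHk => //.
exact: (iffLR (mem_upper_centralS _ _)).
Qed.

(** With a = b * z and x = y * w, the factor z is central modulo Z_m, and w
    centralizes b ^ y, which is again in gamma_{k+1}, modulo Z_m by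
    [commg_upper_lower_central]. *)
Lemma commg_congr k m a b x y :
    a \in lower_central_rec G k -> b \in lower_central_rec G k ->
    quotient_proj (upper_central G m.+1) a = quotient_proj _ b ->
    quotient_proj (upper_central G (m + k).+1) x = quotient_proj _ y ->
  quotient_proj (upper_central G m) [~ a, x] = quotient_proj _ [~ b, y].
Proof.
move=> La Lb /esym/quotient_projP Zba /esym/quotient_projP Zyx.
rewrite -[a](mulVKg b) -[x](mulVKg y).
set z := b^-1 * a in Zba *; set w := y^-1 * x in Zyx *.
have Cw u : u \in lower_central_rec G k ->
    quotient_proj (upper_central G m) (u ^ w) = quotient_proj _ u.
  move=> Lu; rewrite gmulfJ; apply/conjg_fixP/commgP/commute_sym.
  exact/commute_quotient_proj/(commg_upper_lower_central Lu).
have Cz u : commute (quotient_proj (upper_central G m) z) u.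
  rewrite -[u]quotient_reprK; apply/commute_quotient_proj.
  exact: (iffLR (mem_upper_centralS _ _)).
have -> : [~ b * z, y * w] = z^-1 * (b^-1 * (b ^ y) ^ w) * z ^ (y * w).
  by rewrite commgEl conjMg -conjgM invgM !mulgA.
have by_w : quotient_proj (upper_central G m) (b^-1 * (b ^ y) ^ w) =
    quotient_proj _ [~ b, y].
  rewrite commgEl gmulfM [RHS]gmulfM; congr (_ * _).
  exact/Cw/lower_central_rec_conj.
have zyw : quotient_proj (upper_central G m) (z ^ (y * w)) = quotient_proj _ z.
  by rewrite gmulfJ; apply/conjg_fixP/commgP.
(* Restated so that rewriting sees products only, without unfolding
   conjugates. *)
have projM u v : quotient_proj (upper_central G m) (u * v) =
    quotient_proj _ u * quotient_proj _ v by exact: gmulfM.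
by rewrite projM zyw projM by_w -mulgA -Cz mulgA -(projM z^-1) mulVg gmulf1
  mul1g.
Qed.

(** Each bracketing with a further entry raises the weight k of the partial
    commutators by one and lowers by one the level modulo which they agree;
    after n steps this level is Z_0 = 1. *)
Lemma left_commutator_congr n (s t : n.+1.-tuple G) :
    (forall i, quotient_proj (upper_central G n) (tnth s i) =
               quotient_proj (upper_central G n) (tnth t i)) ->
  left_commutator s = left_commutator t.
Proof.
case/tupleP: s => a s; case/tupleP: t => b t st.
rewrite /left_commutator !theadE /=.
(* The later entries stay congruent modulo the same upper center throughout,
   of index the sum of the remaining steps and of the k steps done so far;
   here k = 0. *)
have {st}[ab st] : quotient_proj (upper_central G n) a = quotient_proj _ b /\
    forall i, quotient_proj (upper_central G (n + 0)) (tnth s i) =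
              quotient_proj _ (tnth t i).
  rewrite addn0; split=> [|i]; first by have := st ord0; rewrite !tnth0.
  by have := st (lift ord0 i); rewrite !tnthS.
have La : a \in lower_central_rec G 0 by [].
have Lb : b \in lower_central_rec G 0 by [].
elim: n 0%N a b s t ab st La Lb => [|n IHn] k a b s t ab st La Lb.
  rewrite (tuple0 s) (tuple0 t) /=; have /quotient_projP := ab.
  by move=> /eqP/mulg1_eq; rewrite invgK.
case/tupleP: s st => x s; case/tupleP: t => y t st /=.
apply: (IHn k.+1).
- apply: commg_congr La Lb ab _.
  by have := st ord0; rewrite !tnth0.
- by move=> i; rewrite addnS; have := st (lift ord0 i); rewrite !tnthS.
- by apply/sub_generated/asboolP; exists a, x.
- by apply/sub_generated/asboolP; exists b, y.
Qed.

End Group.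

(** * Isoclinism from a pair of relations *)

(** One direction of the correspondence; applied to R, S and to their
    converses, it gives both. *)
Section HalfCorrespondence.
Variables (n : nat) (A B : groupType) (R S : A -> B -> Prop).
Hypothesis RS : forall (s : n.+1.-tuple A) (t : n.+1.-tuple B),
  (forall i, R (tnth s i) (tnth t i)) ->
  S (left_commutator s) (left_commutator t).

Lemma correspondence_upper_central a b :
    (forall y, exists x, R x y) -> (forall y, S 1 y -> y = 1) ->
  R a b -> a \in upper_central A n -> b \in upper_central B n.
Proof.
move=> /choice [g Rg] Sker Rab /mem_upper_central Za.
apply/mem_upper_central => t; apply: Sker; rewrite -(Za (map_tuple g t)).
apply: RS => i; case: (unliftP ord0 i) => [j|] ->; last by rewrite !tnth0.
by rewrite !tnthS tnth_map.
Qed.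

Lemma correspondence_lower_central :
    (forall x, exists y, R x y) -> S 1 1 ->
    (forall a a' b b', S a b -> S a' b' -> S (a / a') (b / b')) ->
  {in lower_central A n.+1, forall x,
    exists2 y, y \in lower_central B n.+1 & S x y}.
Proof.
move=> /choice [f Rf] S1 Sdiv; apply: lower_central_ind.
- by exists 1; rewrite ?gpred1.
- move=> x x' [y Ly Sxy] [y' Ly' Sxy']; exists (y / y'); last exact: Sdiv.
  exact: gpredF.
- move=> s; exists (left_commutator (map_tuple f s)).
    exact: left_commutator_lower_central.
  by apply: RS => i; rewrite tnth_map.
Qed.

End HalfCorrespondence.

(** R is the graph of an isomorphism up to n-central ambiguity, and S is the
    graph of an isomorphism between a subgroup of A and a subgroup of B, which
    matches the commutators of R-related tuples. *)
Lemma correspondence_isoclinic (n : nat) (A B : groupType)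
    (R S : A -> B -> Prop) :
    (forall a, exists b, R a b) -> (forall b, exists a, R a b) ->
    (forall a a' b b', R a b -> R a' b' -> R (a / a') (b / b')) ->
    S 1 1 ->
    (forall a a' b b', S a b -> S a' b' -> S (a / a') (b / b')) ->
    (forall a b, S a b -> a = 1 <-> b = 1) ->
    (forall (s : n.+1.-tuple A) (t : n.+1.-tuple B),
       (forall i, R (tnth s i) (tnth t i)) ->
       S (left_commutator s) (left_commutator t)) ->
  isoclinic n A B.
Proof.
move=> Rtotal Ronto Rdiv S1 Sdiv Sker RS.
pose flip (T : A -> B -> Prop) b a := T a b.
have SR (t : n.+1.-tuple B) (s : n.+1.-tuple A) :
    (forall i, flip R (tnth t i) (tnth s i)) ->
  flip S (left_commutator t) (left_commutator s) by move=> ts; apply: RS.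
have RZ a b : R a b -> a \in upper_central A n <-> b \in upper_central B n.
  move=> Rab; split; first apply: (correspondence_upper_central RS) Rab => //.
    by move=> y Sy; apply/(Sker _ _ Sy).
  apply: (correspondence_upper_central SR) Rab => //.
  by move=> x Sx; apply/(Sker _ _ Sx).
pose Ralpha (u : quotient_type (upper_central A n))
    (v : quotient_type (upper_central B n)) :=
  exists a b, [/\ quotient_proj _ a = u, quotient_proj _ b = v & R a b].
pose Rbeta (u : subgroup_type (lower_central A n.+1))
    (v : subgroup_type (lower_central B n.+1)) := S (val u) (val v).
have [||||alpha alpha_bij alphaE] := @correspondence_isomorphism _ _ Ralpha.
- move=> u; have [b Rb] := Rtotal (repr u).
  by exists (quotient_proj _ b), (repr u), b; split=> //; apply: quotient_reprK.
- move=> v; have [a Ra] := Ronto (repr v).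
  by exists (quotient_proj _ a), a, (repr v); split=> //; apply: quotient_reprK.
- move=> _ _ _ _ [a [b [<- <- Rab]]] [a' [b' [<- <- Rab']]].
  by exists (a / a'), (b / b'); rewrite !gmulfF; split=> //; apply: Rdiv.
- by move=> _ _ [a [b [<- <- /RZ ab]]]; rewrite !quotient_proj_eq1.
have [||||beta beta_bij betaE] := @correspondence_isomorphism _ _ Rbeta.
- move=> [x Lx].
  have [y Ly Sxy] := correspondence_lower_central RS Rtotal S1 Sdiv Lx.
  by exists (exist _ y Ly).
- move=> [y Ly].
  have Sdiv' a a' b b' : flip S a b -> flip S a' b' -> flip S (a / a') (b / b').
    exact: Sdiv.
  have [x Lx Sxy] := correspondence_lower_central SR Ronto S1 Sdiv' Ly.
  by exists (exist _ x Lx).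
- by move=> u u' v v' Suv Suv'; rewrite /Rbeta !gmulfF; apply: Sdiv.
- move=> u v /Sker uv; have valE1 (C : groupType) (K : groupClosed C)
    (w : subgroup_type K) : w = 1 <-> val w = 1.
    by split=> [->|w1]; [rewrite gmulf1 | apply: val_inj; rewrite gmulf1].
  by rewrite !valE1.
exists alpha, beta; split=> // g h gh.
(* h need not be R-related to g; it is only congruent to f o g, which is. *)
have [f Rf] := choice Rtotal.
apply: betaE; rewrite /Rbeta /=.
have -> : left_commutator h = left_commutator (map_tuple f g).
  apply: left_commutator_congr => i; rewrite -gh tnth_map; apply: alphaE.
  by exists (tnth g i), (f (tnth g i)).
by apply: RS => i; rewrite tnth_map.
Qed.

(** * Subgroups of isoclinic groups *)

Theorem theoremA (n : nat) (n_gt0 : (0 < n)%N) (G1 G2 : groupType)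
    (G1_isoclinic_G2 : isoclinic n G1 G2) (H1 : groupClosed G1) :
  exists H2 : groupClosed G2, isoclinic n (subgroup_type H1) (subgroup_type H2).
Proof.
have [alpha [beta [_ beta_bij alpha_beta]]] := G1_isoclinic_G2.
pose Q x y := alpha (quotient_proj _ x) = quotient_proj _ y.
have Qdiv x x' y y' : Q x y -> Q x' y' -> Q (x / x') (y / y').
  move=> Qxy Qxy'; rewrite /Q !multiplicativeF.
  by congr (_ / _); [exact: Qxy | exact: Qxy'].
have clH2 : group_closed (fun y => `[< exists2 x, x \in H1 & Q x y >]).
  split=> [|y y' /asboolP [x Hx Qxy] /asboolP [x' Hx' Qxy']]; apply/asboolP.
    by exists 1; rewrite ?gpred1 // /Q !multiplicative1.
  by exists (x / x'); [exact: gpredF | exact: Qdiv].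
pose H2 := mk_subgroup clH2; exists H2.
pose R (x : subgroup_type H1) (y : subgroup_type H2) := Q (val x) (val y).
pose S (x : subgroup_type H1) (y : subgroup_type H2) :=
  exists2 u, val u = val x & val (beta u) = val y.
apply: (@correspondence_isoclinic _ _ _ R S).
- move=> [x Hx]; pose y := repr (alpha (quotient_proj _ x)).
  have Qxy : Q x y by rewrite /Q quotient_reprK.
  have Hy : y \in H2 by apply/asboolP; exists x.
  by exists (exist _ y Hy).
- by move=> [y Hy]; have /asboolP [x Hx Qxy] := Hy; exists (exist _ x Hx).
- by move=> x x' y y' Rxy Rxy'; rewrite /R !multiplicativeF; apply: Qdiv.
- by exists 1; rewrite !multiplicative1.
- move=> x x' y y' [u ux uy] [u' ux' uy'].
  by exists (u / u'); rewrite !multiplicativeF; congr (_ / _).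
- move=> x y [u ux uy]; split=> [x1|y1].
    apply: val_inj; rewrite -uy; suff -> : u = 1 by rewrite !multiplicative1.
    by apply: val_inj; rewrite ux x1 !multiplicative1.
  apply: val_inj; rewrite -ux; suff -> : u = 1 by rewrite !multiplicative1.
  apply: (bij_inj beta_bij); apply: val_inj.
  by rewrite uy y1 !multiplicative1.
move=> s t st; exists (commutator_map (map_tuple val s)).
  by rewrite (left_commutator_morph _ (@gmulfR _ _ val)).
rewrite (left_commutator_morph _ (@gmulfR _ _ val)).
rewrite (alpha_beta _ (map_tuple val t)) // => i.
by rewrite !tnth_map; apply: st.
Qed.
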